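(* Let $f(x,y)>0$ be a conformal factor on the unit square torus $\mathbb{R}^2/\mathbb{Z}^2$ and let $\mathcal{G}=f^2\,(dx^2+dy^2)$ be the corresponding metric on $\mathbb{R}^2/\mathbb{Z}^2$. Then $$\operatorname{area}(\mathcal{G}) - \operatorname{sys}(\mathcal{G})^2 \;\geq\; \operatorname{Var}(f) + \tfrac{1}{16}\,\bigl|P_{\mathrm{BA}}(f)\bigr|_1^2 ,$$ where $P_{\mathrm{BA}}(f)$ is the biaxial projection of $f$.
   Context: The systole $\operatorname{sys}(\mathcal{G})$ is the least $\mathcal{G}$-length of a noncontractible loop on the torus; $\operatorname{area}(\mathcal{G})$ is the total area. Expectation and variance are with respect to the measure $dx\,dy$ on $\mathbb{R}^2/\mathbb{Z}^2$ (a probability measure): $E(f)=\int f\,dx\,dy$, $\operatorname{Var}(f)=\int (f-E(f))^2\,dx\,dy$. $|\cdot|_1$ is the $L^1$-norm on $\mathbb{R}^2/\mathbb{Z}^2$ with respect to $dx\,dy$. Biaxial projection: a doubly periodic function $f$ on $\mathbb{R}^2/\mathbb{Z}^2$ is decomposed as $f(x,y)=E(f)+g_f(x)+h_f(y)+k_f(x,y)$, where the single-variable functions $g_f,h_f$ have zero means and $k_f$ has zero mean along every vertical and horizontal unit interval. Explicitly $g_f(x)=\int_0^1 f(x,y)\,dy-E(f)$ and $h_f(y)=\int_0^1 f(x,y)\,dx-E(f)$. Then $P_{\mathrm{BA}}(f)(x,y)=g_f(x)+h_f(y)$. (In terms of the double Fourier series of $f$, this extracts the $(m,n)$-terms with $mn=0$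 and $(m,n)\neq(0,0)$.) *)

(* Defs.v *)
From HB Require Import structures.
From mathcomp Require Import all_boot all_order all_algebra generic_quotient.
From mathcomp Require Import all_classical all_reals all_analysis.

Set Implicit Arguments.
Unset Strict Implicit.
Unset Printing Implicit Defensive.

Import Order.TTheory GRing.Theory Num.Theory.
Import numFieldNormedType.Exports.

Local Open Scope ring_scope.
Local Open Scope classical_set_scope.
Local Open Scope quotient_scope.

(* Congruence modulo the lattice Z^2. *)
Definition lattice_eq {R : realType} (z w : R * R) : bool :=
  (z.1 - w.1 \is a Num.int) && (z.2 - w.2 \is a Num.int).

Lemma lattice_eq_refl {R : realType} : reflexive (@lattice_eq R).
Proof. by move=> z; rewrite /lattice_eq !subrr !rpred0. Qed.

Lemma lattice_eq_sym {R : realType} : symmetric (@lattice_eq R).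
Proof.
move=> z w; rewrite /lattice_eq -(opprB w.1 z.1) rpredN.
by rewrite -(opprB w.2 z.2) rpredN.
Qed.

Lemma lattice_eq_trans {R : realType} : transitive (@lattice_eq R).
Proof.
move=> w z u /andP[a1 a2] /andP[b1 b2]; rewrite /lattice_eq.
by rewrite -(subrKA w.1 z.1) -(subrKA w.2 z.2) (rpredD a1 b1) (rpredD a2 b2).
Qed.

Canonical lattice_equiv {R : realType} :=
  EquivRel (@lattice_eq R) lattice_eq_refl lattice_eq_sym lattice_eq_trans.

Definition torus (R : realType) : Type :=
  quotient_topology {eq_quot (@lattice_equiv R)}.

HB.instance Definition _ (R : realType) := Topological.on (torus R).

Definition torus_pi {R : realType} (z : R * R) : torus R :=
  \pi_(quotient_topology {eq_quot (@lattice_equiv R)}) z.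

Definition torus_repr {R : realType} (p : torus R) : R * R :=
  repr (p : {eq_quot (@lattice_equiv R)}).

Lemma torus_reprK {R : realType} : cancel (@torus_repr R) torus_pi.
Proof. by move=> p; exact: (@reprK _ {eq_quot (@lattice_equiv R)}). Qed.

Lemma torus_piP {R : realType} (z w : R * R) :
  torus_pi z = torus_pi w <-> lattice_eq z w.
Proof. by split => [/eqquotP|h]//; apply/eqquotP. Qed.

Section torus_integrals.
Context {R : realType}.
Implicit Types F : torus R -> R.

Local Notation mu := (@lebesgue_measure R).

(* Integration against dx dy, computed on the fundamental domain [0,1]^2. *)
Definition torus_int F : R :=
  \int[(mu \x mu)%E]_(z in `[0%R, 1%R] `*` `[0%R, 1%R]) F (torus_pi z).

(* dx dy has total mass 1 on the torus. *)
Definition torus_E F : R := torus_int F.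

Definition torus_Var F : R := torus_E (fun p => (F p - torus_E F) ^+ 2).

Definition torus_L1norm F : R := torus_int (fun p => `|F p|).

Definition mean_g F (x : R) : R :=
  \int[mu]_(y in `[0%R, 1%R]) F (torus_pi (x, y)) - torus_E F.

Definition mean_h F (y : R) : R :=
  \int[mu]_(x in `[0%R, 1%R]) F (torus_pi (x, y)) - torus_E F.

(* g and h are 1-periodic, so the representative is immaterial: see P_BA_pi. *)
Definition P_BA F (p : torus R) : R :=
  mean_g F (torus_repr p).1 + mean_h F (torus_repr p).2.

Lemma P_BA_pi F (x y : R) : P_BA F (torus_pi (x, y)) = mean_g F x + mean_h F y.
Proof.
have /torus_piP/andP[/= ix iy] := torus_reprK (torus_pi (x, y)).
rewrite /P_BA /mean_g /mean_h; congr (_ - _ + (_ - _)).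
  apply: eq_Rintegral => v _; congr F; apply/torus_piP.
  by rewrite /lattice_eq /= ix subrr rpred0.
apply: eq_Rintegral => u _; congr F; apply/torus_piP.
by rewrite /lattice_eq /= iy subrr rpred0.
Qed.

End torus_integrals.

Section metrics.
Context {R : realType}.

(* A metric is given by its Gram matrix in the global frame d/dx, d/dy. *)
Definition metric_tensor := torus R -> 'M[R]_2.

Implicit Type G : metric_tensor.

Definition conformal_metric (f : torus R -> R) : metric_tensor :=
  fun p => (f p ^+ 2) *: 1%:M.

Definition area G : R := torus_int (fun p => Num.sqrt (\det (G p))).

(* A curve in the torus is given by a lift c : [0,1] -> R^2 along the covering
   map torus_pi; the values of c outside [0,1] are irrelevant. *)
Definition velocity (c : R -> R * R) (t : R) : 'rV[R]_2 :=
  \row_(i < 2) (if i == 0 then (fst \o c)^`() t else (snd \o c)^`() t).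

Definition C1_curve (c : R -> R * R) : Prop :=
  [/\ forall t, derivable (fst \o c) t 1, forall t, derivable (snd \o c) t 1,
      continuous (fst \o c)^`() & continuous (snd \o c)^`()].

(* Being C^1 on a closed piece means extending to a C^1 curve on the line. *)
Definition piecewise_C1 (c : R -> R * R) : Prop :=
  exists2 s : seq R, itv_partition 0 1 s &
    forall i, (i < size s)%N -> exists2 d : R -> R * R, C1_curve d &
      {in `[nth 0 (0 :: s) i, nth 0 (0 :: s) i.+1], c =1 d}.

(* The derivative is only unspecified at finitely many times. *)
Definition curve_length G (c : R -> R * R) : R :=
  \int[lebesgue_measure]_(t in `[0%R, 1%R])
    Num.sqrt ((velocity c t *m G (torus_pi (c t)) *m (velocity c t)^T) 0 0).

(* Free null-homotopy of the loop l : [0,1] -> torus. *)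
Definition contractible (l : R -> torus R) : Prop :=
  exists H : R * R -> torus R,
    [/\ {within `[0%R, 1%R] `*` `[0%R, 1%R], continuous H},
        {in `[0%R, 1%R], forall t, H (t, 0) = l t},
        {in `[0%R, 1%R], forall s, H (0, s) = H (1, s)} &
        exists p, {in `[0%R, 1%R], forall t, H (t, 1) = p}].

Definition noncontractible_loop (c : R -> R * R) : Prop :=
  [/\ piecewise_C1 c, torus_pi (c 0) = torus_pi (c 1) &
      ~ contractible (torus_pi \o c)].

Definition sys G : R :=
  inf [set curve_length G c | c in noncontractible_loop].

End metrics.

(* Main.v *)
(* Since area(G) is the integral of f^2, area(G) - Var(f) = E(f)^2. Horizontal and
   vertical straight loops are noncontractible, so their lengths E(f) + h(y) and
   E(f) + g(x) are at least sys(G). Thus g, h >= - m with m = E(f) - sys(G) >= 0,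
   whence |g + h| <= g + h + 4 m; as g and h have zero mean, |P_BA(f)|_1 <= 4 m.
   Finally E(f)^2 - sys(G)^2 = m (m + 2 sys(G)) >= m^2.

   Noncontractibility of the straight loops uses a discrete winding number: along
   a fine enough grid of a homotopy, the signed displacements mod 1 of
   neighbouring points add up around each small square, so the total
   displacement around a row is the same for all rows; it is 1 for the straight
   loop and 0 for a constant one. *)

Require Import Defs.
From mathcomp Require Import all_boot all_order all_algebra.
From mathcomp Require Import all_classical all_reals all_analysis.
From mathcomp Require Import measurable_realfun.
From mathcomp Require Import ring lra zify.

Import Order.TTheory GRing.Theory Num.Theory.
Import numFieldNormedType.Exports.

Local Open Scope classical_set_scope.
Local Open Scope ring_scope.

Set Implicit Arguments.
Unset Strict Implicit.
Unset Printing Implicit Defensive.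

(** * Signed displacement modulo 1 between points of the torus *)

Section displacement.
Context {R : realType} (b : bool).
Implicit Types (p q r : torus R) (z w : R * R).

(** The boolean lets one argument serve both coordinate directions. *)
Definition coord z : R := if b then z.1 else z.2.

(** The floor of [d + 2^-1] is the integer nearest to [d], so this is the representative of the
    coordinate difference modulo 1 lying in [-1/2, 1/2). *)
Definition disp p q : R :=
  let d := coord (torus_repr q) - coord (torus_repr p) in
  d - (Num.floor (d + 2^-1))%:~R.

Lemma disp_int z w :
  coord w - coord z - disp (torus_pi z) (torus_pi w) \is a Num.int.
Proof.
have /torus_piP/andP[z1 z2] := torus_reprK (torus_pi z).
have /torus_piP/andP[w1 w2] := torus_reprK (torus_pi w).
rewrite /disp; set fl := Num.floor _.
have zi : coord (torus_repr (torus_pi z)) - coord z \is a Num.int.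
  by rewrite /coord; case: b.
have wi : coord (torus_repr (torus_pi w)) - coord w \is a Num.int.
  by rewrite /coord; case: b.
rewrite [X in X \is a _](_ : _ = (coord (torus_repr (torus_pi z)) - coord z) -
  (coord (torus_repr (torus_pi w)) - coord w) + fl%:~R); last by ring.
exact: (rpredD (rpredB zi wi) (intr_int _ _)).
Qed.

Lemma disp_bound p q : - 2^-1 <= disp p q < 2^-1.
Proof.
rewrite /disp; set d := coord _ - coord _; have := floor_itv (d + 2^-1).
rewrite intrD mulr1z => /andP[f1 f2]; apply/andP; split; lra.
Qed.

(** Lifting points one after another in this way turns displacements into honest differences of real
    coordinates, which add and change sign as expected. *)
Lemma disp_lift p z : exists2 w, torus_pi w = p &
  coord w - coord z = disp (torus_pi z) p.
Proof.
have := disp_int z (torus_repr p); rewrite torus_reprK.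
set a := _ - _ - _ => ia.
(* Shifting the selected coordinate by the integer [a] does not change the class in the torus. *)
exists (if b then ((torus_repr p).1 - a, (torus_repr p).2)
        else ((torus_repr p).1, (torus_repr p).2 - a)).
  rewrite -[RHS](torus_reprK p); apply/torus_piP; rewrite /lattice_eq.
  by case: b => /=; rewrite subrr rpred0 ?andbT addrAC subrr sub0r rpredN.
by rewrite /a /coord; case: b => /=; lra.
Qed.

Lemma dispE z w : `|coord w - coord z| < 2^-1 ->
  disp (torus_pi z) (torus_pi w) = coord w - coord z.
Proof.
move=> zw; have := disp_int z w; set d := disp _ _; move/intrP => [n nE].
have /andP[d1 d2] := disp_bound (torus_pi z) (torus_pi w).
rewrite -/d in d1 d2; move: zw; rewrite ltr_norml => /andP[e1 e2].
(* Two reals, one of modulus below 1/2 and the other of modulus at most 1/2, differ by the integer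
   [n]; hence [n] is 0. *)
have : (`|n|%:~R : R) < 1%:~R by rewrite intr_norm -nE ltr_norml; lra.
rewrite ltr_int; case: n nE => [[|n]|n]// nE _; lra.
Qed.

(** The strict bound excludes the value -1/2, whose opposite lies outside the range of [disp]. *)
Lemma disp_anti p q : `|disp p q| < 2^-1 -> disp q p = - disp p q.
Proof.
rewrite -(torus_reprK p); have [w <- <-] := disp_lift q (torus_repr p).
by move=> h; rewrite dispE ?opprB// distrC.
Qed.

Lemma dispD p q r : `|disp p q| + `|disp q r| < 2^-1 ->
  disp p r = disp p q + disp q r.
Proof.
rewrite -(torus_reprK p); have [w <- <-] := disp_lift q (torus_repr p).
have [u <- <-] := disp_lift r w => h.
set z := torus_repr p.
have uz : coord u - coord z = coord w - coord z + (coord u - coord w) by ring.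
by rewrite dispE uz//; apply: le_lt_trans (ler_normD _ _) h.
Qed.

Lemma dispxx p : disp p p = 0.
Proof. by rewrite -(torus_reprK p) dispE subrr// normr0 invr_gt0. Qed.

Lemma disp_near p (e : R) : 0 < e -> e < 2^-1 ->
  \forall q \near p, `|disp q p| < e.
Proof.
move=> e0 e2; apply: open_nbhs_nbhs; split; last by rewrite /= dispxx normr0.
(* Openness in the quotient means openness of the preimage in the plane, so it is checked around a
   lift [w]. *)
rewrite /open/= /quotient_open openE => w wp; rewrite /interior /=.
have {}wp : `|disp (torus_pi w) p| < e := wp.
have [z zp zw] := disp_lift p w; move: wp; rewrite -zw => wp.
have coordc : coord x @[x --> w] --> coord w.
  by rewrite /coord; case: b; [exact: cvg_fst|exact: cvg_snd].
have : \forall w1 \near w, `|coord z - coord w1| < e.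
  have e' : 0 < e - `|coord z - coord w| by rewrite subr_gt0.
  move/cvgr_dist_lt : coordc => /(_ _ e'); apply: filterS => w1.
  have -> : coord z - coord w1 = coord z - coord w + (coord w - coord w1) by ring.
  by rewrite ltrBrDl; apply: le_lt_trans; exact: ler_normD.
apply: filterS => w1 /= w1e; change (`|disp (torus_pi w1) p| < e).
by rewrite -zp dispE// (lt_trans w1e).
Qed.

End displacement.

(** * Discrete winding number of a homotopy *)

Section winding.
Context {R : realType} (b : bool).
Local Notation I := (`[0%R, 1%R]%classic : set R).

(** Uniform continuity on the compact square, measured by [disp]. With bound 1/4, two consecutive
    displacements satisfy the hypothesis of [dispD]; [4 <= n] makes the mesh at most 1/5, so [dispE]
    applies to a lift moving by one mesh step. *)
Lemma disp_mesh (H : R * R -> torus R) : {within I `*` I, continuous H} ->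
  exists2 n : nat, (4 <= n)%N & forall z w : R * R, (I `*` I) z -> (I `*` I) w ->
    `|z.1 - w.1| <= n.+1%:R^-1 -> `|z.2 - w.2| <= n.+1%:R^-1 ->
    `|disp b (H z) (H w)| < 4^-1.
Proof.
move=> /subspace_continuousP cH.
have /compact_near_coveringP/near_covering_withinP cov : compact (I `*` I).
  by apply: compact_setX; exact: segment_compact.
pose P (n : nat) (z : R * R) := forall w : R * R, (I `*` I) w ->
  `|z.1 - w.1| <= n.+1%:R^-1 -> `|z.2 - w.2| <= n.+1%:R^-1 ->
  `|disp b (H z) (H w)| < 4^-1.
(* Compactness, as a near-covering property, makes one [n] work for all [z] once it works locally
   around each [x]. The local bound 1/8 is used twice, from [z] to [x] and from [x] to [w]. *)
have : \forall n \near \oo, I `*` I `<=` P n.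
  apply: (cov nat \oo P) => x Kx.
  have h8 : 0 < 8^-1 :> R by lra.
  have h82 : 8^-1 < 2^-1 :> R by lra.
  have := cH x Kx _ (disp_near b (H x) h8 h82).
  rewrite /fmap /= /within /= => /nbhs_ballP[r /= r0 rH].
  near=> z n => /= Kz w Kw zw1 zw2.
  have [/= xz1 xz2] : ball x (r / 2) z.
    by near: z; apply: nbhsx_ballx; rewrite divr_gt0.
  have nr : n.+1%:R^-1 < r / 2.
    near: n; exact: (near_infty_natSinv_lt (PosNum (divr_gt0 r0 (ltr0Sn R 1)))).
  have half (v s t : R) : `|s - v| < r / 2 -> `|v - t| <= n.+1%:R^-1 ->
      `|s - t| < r.
    move=> h1 h2; have -> : s - t = (s - v) + (v - t) by ring.
    apply: le_lt_trans (ler_normD _ _) _.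
    by rewrite (splitr r) ltrD// (le_lt_trans h2).
  have dz : `|disp b (H z) (H x)| < 8^-1.
    apply: rH => //; split.
      by apply: (lt_trans xz1); lra.
    by apply: (lt_trans xz2); lra.
  have dw : `|disp b (H w) (H x)| < 8^-1.
    apply: rH => //; split.
      exact: half xz1 zw1.
    exact: half xz2 zw2.
  have dw' : `|disp b (H x) (H w)| < 8^-1.
    by rewrite disp_anti ?normrN// (lt_trans dw).
  rewrite (dispD (q := H x)); last by lra.
  by apply: le_lt_trans (ler_normD _ _) _; lra.
move=> nearP; have : \forall n \near \oo, (4 <= n)%N /\ I `*` I `<=` P n.
  by near=> n; split; near: n => //; exact: nbhs_infty_ge.
move=> [n _ /(_ n (leqnn n))[n4 nP]]; exists n => // z w Kz; exact: nP.
Unshelve. all: by end_near. Qed.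

Lemma coord_loop_noncontractible (c : R -> R * R) :
  (forall t, coord b (c t) = t) -> ~ contractible (torus_pi \o c).
Proof.
move=> cE [H [/disp_mesh[n n4 mesh] H0 Hper [p H1]]].
pose t (i : nat) : R := i%:R / n.+1%:R.
have n0 : 0 < n.+1%:R :> R by rewrite ltr0n.
have t0 : t 0 = 0 by rewrite /t mul0r.
have tn : t n.+1 = 1 by rewrite /t divff// gt_eqF.
have tI i : (i <= n.+1)%N -> t i \in `[0, 1].
  by move=> ni; rewrite in_itv /= divr_ge0//= ler_pdivrMr// mul1r ler_nat.
have tIc i : (i <= n.+1)%N -> t i \in `[0, 1]%classic.
  by move=> ni; apply: mem_set; exact: tI.
have tS i : t i.+1 - t i = n.+1%:R^-1.
  by rewrite /t -mulrBl -natrB// subSnn mul1r.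
have ninv : n.+1%:R^-1 <= 5^-1 :> R.
  by rewrite lef_pV2 ?posrE// ler_nat.
have ninv0 : 0 < n.+1%:R^-1 :> R by rewrite invr_gt0.
pose a i j := H (t i, t j).
have step i j i' j' : (i <= i' <= n.+1)%N -> (j <= j' <= n.+1)%N ->
    (i' <= i.+1)%N -> (j' <= j.+1)%N -> `|disp b (a i j) (a i' j')| < 4^-1.
  have tclose k k' : (k <= k')%N -> (k' <= k.+1)%N -> `|t k - t k'| <= n.+1%:R^-1.
    rewrite leq_eqVlt => /predU1P[<-|kk' k'k]; first by rewrite subrr normr0 ltW.
    by rewrite (@anti_leq k' k.+1) ?k'k// distrC tS gtr0_norm.
  move=> /andP[ii' i'n] /andP[jj' j'n] i'i j'j.
  apply: mesh => /=; [split|split|exact: tclose|exact: tclose]; apply: tI => //.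
    exact: leq_trans i'n.
  exact: leq_trans j'n.
(* [w j] is the winding number of row [j] of the grid. *)
pose w j := \sum_(0 <= i < n.+1) disp b (a i j) (a i.+1 j).
have wS j : (j < n.+1)%N -> w j = w j.+1.
  move=> jn; apply/eqP; rewrite -subr_eq0 -sumrB; apply/eqP.
  pose v i := disp b (a i j) (a i j.+1).
  (* Both ways around a small square add up to the displacement along its diagonal, so the rows
     differ by a telescoping sum of the vertical displacements [v]. Its end terms agree because [H]
     is a loop at every height. *)
  transitivity (- \sum_(0 <= i < n.+1) (v i.+1 - v i)).
    rewrite -sumrN; apply: eq_big_nat => i /= in'; rewrite /v.
    have d1 : `|disp b (a i j) (a i.+1 j)| < 4^-1 by apply: step; lia.
    have d2 : `|disp b (a i.+1 j) (a i.+1 j.+1)| < 4^-1 by apply: step; lia.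
    have d3 : `|disp b (a i j) (a i j.+1)| < 4^-1 by apply: step; lia.
    have d4 : `|disp b (a i j.+1) (a i.+1 j.+1)| < 4^-1 by apply: step; lia.
    have := @dispD _ b (a i j) (a i.+1 j) (a i.+1 j.+1).
    rewrite (@dispD _ b (a i j) (a i j.+1) (a i.+1 j.+1)); last by lra.
    by move=> e; have {e} := e ltac:(lra); lra.
  rewrite telescope_sumr// /v /a tn t0 !Hper ?subrr ?oppr0//; apply: tIc => //.
  exact: ltnW.
have w01 : w 0%N = w n.+1.
  have w0j j : (j <= n.+1)%N -> w 0%N = w j.
    by elim: j => // j IH jn; rewrite IH ?(ltnW jn)// wS.
  exact: w0j.
have w1 : w n.+1 = 0.
  rewrite /w big_nat big1// => i /= ni; rewrite /a tn !H1 ?dispxx// tIc//.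
  exact: ltnW.
have w0 : w 0%N = 1.
  (* Along the bottom row each displacement is the true increment of [t], and these increments sum
     to 1. *)
  rewrite -tn -[RHS]subr0 -t0 -telescope_sumr//; apply: eq_big_nat => i /= ni.
  rewrite /a t0 !H0 ?tIc//; last exact: ltnW.
  by rewrite /= dispE !cE// tS gtr0_norm// (le_lt_trans ninv)//; lra.
by move: w01; rewrite w0 w1 => /eqP; rewrite oner_eq0.
Qed.

End winding.

(** * Measurability, integrability and Fubini for continuous functions on the plane *)

Section continuous_plane.
Context {R : realType}.
Local Notation mu := (@lebesgue_measure R).
Local Notation I := (`[0%R, 1%R]%classic : set R).
Local Notation mu2 := (mu \x mu)%E.
Implicit Type F : R * R -> R.

(** An open set is a countable union of squares with rational centres and radii [n.+1%:R^-1], and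
    squares are measurable rectangles of the product sigma-algebra. *)
Lemma open_measurable_prod (U : set (R * R)) : open U -> measurable U.
Proof.
move=> oU.
pose B (q : rat * rat) (n : nat) : set (R * R) :=
  ball (ratr q.1 : R) n.+1%:R^-1 `*` ball (ratr q.2 : R) n.+1%:R^-1.
have -> : U = \bigcup_(q in [set: rat * rat])
    \bigcup_(n in [set n | B q n `<=` U]) B q n.
  apply/seteqP; split=> [z Uz|z [q _ [n BU]]]; last exact: BU.
  have /nbhs_ballP[r /= r0 rU] : nbhs z U by exact: open_nbhs_nbhs.
  have [n nr] : exists n : nat, n.+1%:R^-1 < r / 2.
    have [n _ nP] := near_infty_natSinv_lt (PosNum (divr_gt0 r0 (ltr0Sn R 1))).
    by exists n; exact: nP (leqnn n).
  have n0 : 0 < n.+1%:R^-1 :> R by rewrite invr_gt0.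
  have ratP (x : R) : exists q : rat, `|ratr q - x| < n.+1%:R^-1.
    have /rat_in_itvoo[q] : x - n.+1%:R^-1 < x + n.+1%:R^-1 by rewrite ltrD2l gtrN.
    by rewrite in_itv /= => /andP[q1 q2]; exists q; rewrite ltr_distl q1 q2.
  have [[q1 z1] [q2 z2]] := (ratP z.1, ratP z.2).
  exists (q1, q2) => //; exists n => [|//] w [/= w1 w2]; apply: rU.
  have half (a c d : R) : `|a - c| < n.+1%:R^-1 ->
      `|a - d| < n.+1%:R^-1 -> `|c - d| < r.
    move=> h1 h2; have -> : c - d = (a - d) - (a - c) by ring.
    apply: le_lt_trans (ler_normB _ _) _.
    by rewrite (splitr r) ltrD// (lt_trans _ nr).
  by split; [exact: half z1 w1|exact: half z2 w2].
apply: countable_bigcupT_measurable => [|q]; first exact: countableP.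
apply: bigcup_measurable => n _.
by apply: measurableX; apply: open_measurable; exact: ball_open.
Qed.

Lemma continuous_measurable_prod F : continuous F -> measurable_fun setT F.
Proof.
move=> /continuousP cF; apply: (measurability _ (RGenOpens.measurableE R)).
move=> _ [_ [a [b ->] <-]]; rewrite setTI; apply: open_measurable_prod.
exact/cF/interval_open.
Qed.

Lemma lebesgue_measure_square1 : mu2 (I `*` I) = 1%E.
Proof.
by rewrite product_measure1E//= lebesgue_measure_itv /= lte01 oppr0 adde0 mule1.
Qed.

Lemma continuous_integrable_square F : continuous F ->
  mu2.-integrable (I `*` I) (EFin \o F).
Proof.
move=> cF; apply: measurable_bounded_integrable; first exact: measurableX.
- by apply: le_lt_trans (ltry 1); rewrite -lebesgue_measure_square1.
- by apply: measurable_funTS; exact: continuous_measurable_prod.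
have : compact (F @` (I `*` I)).
  apply: continuous_compact; first exact: continuous_subspaceT.
  by apply: compact_setX; exact: segment_compact.
move=> /compact_bounded[M [_ MF]].
by exists M; split; rewrite ?num_real// => ? ? ? ?; exact: MF.
Qed.

Lemma continuous_slice1 F x : continuous F -> continuous (fun y => F (x, y)).
Proof.
move=> cF y; apply: (@continuous_comp _ _ _ (fun y => (x, y)) F); last exact: cF.
by apply: (@cvg_pair _ _ _ _ (nbhs x) (nbhs y)); [exact: cvg_cst|exact: cvg_id].
Qed.

Lemma continuous_swap F : continuous F ->
  continuous (fun z : R * R => F (z.2, z.1)).
Proof.
move=> cF z.
apply: (@continuous_comp _ _ _ (fun z : R * R => (z.2, z.1)) F); last exact: cF.
by apply: (@cvg_pair _ _ _ _ (nbhs z.2) (nbhs z.1));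
  [exact: cvg_snd|exact: cvg_fst].
Qed.

Lemma continuous_integrable_itv (g : R -> R) : continuous g ->
  mu.-integrable I (EFin \o g).
Proof.
move=> cg; apply: continuous_compact_integrable; first exact: segment_compact.
exact: continuous_subspaceT.
Qed.

Lemma continuous_Rintegral_slice F : continuous F ->
  continuous (fun x => \int[mu]_(y in I) F (x, y)).
Proof.
move=> cF x.
(* A bound on the compact strip around [x] is the dominating constant for continuity under the
   integral sign. *)
have [M Mge] : exists M : R, forall u v, x - 1 < u < x + 1 -> I v ->
    `|F (u, v)| <= M.
  have : compact (F @` (`[x - 1, x + 1]%classic `*` I)).
    apply: continuous_compact; first exact: continuous_subspaceT.
    by apply: compact_setX; exact: segment_compact.
  move=> /compact_bounded[M [_ MF]]; exists (M + 1) => u v /andP[u1 u2] Iv.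
  apply: (MF (M + 1)); rewrite ?ltrDl//.
  by exists (u, v) => //; split => //=; rewrite in_itv /= !ltW.
apply: (@continuity_under_integral _ _ _ mu (fun x y => F (x, y)) I _
  (x - 1) (x + 1) _ _ (cst M)) => //.
- by move=> u _; apply: continuous_integrable_itv; exact: continuous_slice1.
- apply: aeW => y _ u _.
  exact: (continuous_slice1 (F := fun z => F (z.2, z.1)) (x := y)
    (continuous_swap cF)).
- by apply: continuous_integrable_itv => u; exact: cvg_cst.
- by move=> u; rewrite /= in_itv /= => hu; apply: aeW => y Iy; exact: Mge.
- by rewrite inE /= in_itv /= ltrDl ltrBlDr ltrDl ltr01.
Qed.

Lemma Rintegral_square12 F : continuous F ->
  \int[mu2]_(z in I `*` I) F z = \int[mu]_(x in I) \int[mu]_(y in I) F (x, y).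
Proof.
move=> cF; have intF := continuous_integrable_square cF.
rewrite /Rintegral; congr fine.
(* Extending [F] by zero outside the square allows Fubini on the whole plane; the inner integral is
   finite, so [fine] loses nothing. *)
rewrite integral_mkcond -integral12_prod_meas1//=; last first.
  by apply: (integrable_mkcond _ _).1 intF; exact: measurableX.
rewrite [RHS]integral_mkcond; apply: eq_integral => x _.
rewrite /fubini_F patchE; case: ifPn => xI.
  rewrite fineK; last first.
    apply: integrable_fin_num => //; apply: continuous_integrable_itv.
    exact: continuous_slice1.
  rewrite [RHS]integral_mkcond; apply: eq_integral => y _.
  rewrite !patchE; congr (if _ then _ else _).
  by rewrite in_setX xI.
by apply: integral0_eq => y _; rewrite patchE in_setX (negbTE xI).
Qed.

Lemma Rintegral_square21 F : continuous F ->
  \int[mu2]_(z in I `*` I) F z = \int[mu]_(y in I) \int[mu]_(x in I) F (x, y).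
Proof.
move=> cF; have intF := continuous_integrable_square cF.
rewrite /Rintegral; congr fine.
rewrite integral_mkcond -integral21_prod_meas1//=; last first.
  by apply: (integrable_mkcond _ _).1 intF; exact: measurableX.
rewrite [RHS]integral_mkcond; apply: eq_integral => x _.
rewrite /fubini_G patchE; case: ifPn => xI.
  rewrite fineK; last first.
    apply: integrable_fin_num => //; apply: continuous_integrable_itv.
    exact: (continuous_slice1 (F := fun z => F (z.2, z.1)) (continuous_swap cF)).
  rewrite [RHS]integral_mkcond; apply: eq_integral => y _.
  rewrite !patchE; congr (if _ then _ else _).
  by rewrite in_setX xI andbT.
by apply: integral0_eq => y _; rewrite patchE in_setX (negbTE xI) andbF.
Qed.

End continuous_plane.

(** * Straight loops and their comparison with the systole *)

Section loops.
Context {R : realType}.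
Local Notation mu := (@lebesgue_measure R).
Local Notation I := (`[0%R, 1%R]%classic : set R).
Implicit Type f : torus R -> R.

(** Horizontal for [true], vertical for [false], so that [coord b] along the loop is the time
    [t]. *)
Definition straight_loop (b : bool) (a t : R) : R * R :=
  if b then (t, a) else (a, t).

Lemma straight_loop_noncontractible b a :
  noncontractible_loop (straight_loop b a).
Proof.
split; last by apply: (@coord_loop_noncontractible _ b) => t; case: b.
  exists [:: 1]; first exact: itv_partition1.
  move=> [|//] _; exists (straight_loop b a) => //.
  have idc : continuous (derive1 (id : R -> R) : R -> R).
    have -> : (derive1 (id : R -> R) : R -> R) = cst 1 by exact/funext/derive1_id.
    by move=> t; exact: cvg_cst.
  have cstc : continuous (derive1 (cst a : R -> R) : R -> R).
    have -> : (derive1 (cst a : R -> R) : R -> R) = cst 0.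
      exact/funext/derive1_cst.
    by move=> t; exact: cvg_cst.
  have did (t : R) : derivable (id : R -> R) t 1 by exact: derivable_id.
  have dcst (t : R) : derivable (cst a : R -> R) t 1 by exact: derivable_cst.
  by case: b; [exact: And4 did dcst idc cstc|exact: And4 dcst did cstc idc].
apply/torus_piP; rewrite /lattice_eq.
by case: b => /=; rewrite subrr sub0r rpredN rpred0 rpred1.
Qed.

Lemma straight_loop_velocity b a t :
  velocity (straight_loop b a) t = \row_i ((i == 0) == b)%:R.
Proof.
apply/rowP => i; rewrite !mxE.
by case: b; case: ifPn => _ /=;
  rewrite -?[RHS](derive1_id t) -?[RHS](derive1_cst a t).
Qed.

(** The Euclidean speed is 1, so the speed in the metric is the square root of [f ^+ 2], which is
    [f] by nonnegativity. *)
Lemma straight_loop_length f b a : (forall p, 0 <= f p) ->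
  curve_length (conformal_metric f) (straight_loop b a) =
  \int[mu]_(t in I) f (torus_pi (straight_loop b a t)).
Proof.
move=> f0; apply: eq_Rintegral => t _.
rewrite /conformal_metric straight_loop_velocity -scalemxAr mulmx1 -scalemxAl.
rewrite !mxE big_ord_recl big_ord1 !mxE /=.
by case: b; rewrite /= !mulr1 ?mulr0 ?addr0 ?add0r mulr1 sqrtr_sqr ger0_norm.
Qed.

Lemma sys_ge0 G : 0 <= @sys R G.
Proof.
apply: lb_le_inf.
  (* A straight loop shows that the set of lengths is nonempty, so its infimum is not a default
     value. *)
  by exists (curve_length G (straight_loop true 0)), (straight_loop true 0) => //;
    exact: straight_loop_noncontractible.
by move=> _ [c _ <-]; apply: Rintegral_ge0 => t _; exact: sqrtr_ge0.
Qed.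

Lemma sys_le_straight f b a : (forall p, 0 <= f p) ->
  sys (conformal_metric f) <=
    \int[mu]_(t in I) f (torus_pi (straight_loop b a t)).
Proof.
move=> f0; rewrite -straight_loop_length//; apply: ge_inf.
  by exists 0 => _ [c _ <-]; apply: Rintegral_ge0 => t _; exact: sqrtr_ge0.
by exists (straight_loop b a) => //; exact: straight_loop_noncontractible.
Qed.

End loops.

(** * Linearity, monotonicity and one-variable integrands on the unit square *)

Section square.
Context {R : realType}.
Local Notation mu := (@lebesgue_measure R).
Local Notation I := (`[0%R, 1%R]%classic : set R).
Local Notation sqint F := (\int[(mu \x mu)%E]_(z in I `*` I) F z).
Implicit Type F : R * R -> R.

Lemma Rintegral_squareD F1 F2 : continuous F1 -> continuous F2 ->
  sqint (fun z => F1 z + F2 z) = sqint F1 + sqint F2.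
Proof.
move=> c1 c2; apply: RintegralD; first exact: measurableX.
  exact: continuous_integrable_square.
exact: continuous_integrable_square.
Qed.

Lemma Rintegral_squareZl F (k : R) : continuous F ->
  sqint (fun z => k * F z) = k * sqint F.
Proof.
move=> c; apply: RintegralZl; first exact: measurableX.
exact: continuous_integrable_square.
Qed.

Lemma Rintegral_square_cst (k : R) : sqint (cst k) = k.
Proof.
rewrite Rintegral_cst; last exact: measurableX.
by rewrite [X in fine X](_ : _ = 1%E) ?mulr1//; exact: lebesgue_measure_square1.
Qed.

Lemma Rintegral_square_fst (G : R -> R) : continuous G ->
  sqint (G \o fst) = \int[mu]_(x in I) G x.
Proof.
move=> cG; rewrite Rintegral_square12; last first.
  by move=> z; apply: continuous_comp; [exact: cvg_fst|exact: cG].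
apply: eq_Rintegral => x _ /=; rewrite Rintegral_cst//=.
by rewrite lebesgue_measure_itv /= lte01 oppr0 adde0 mulr1.
Qed.

Lemma Rintegral_square_snd (G : R -> R) : continuous G ->
  sqint (G \o snd) = \int[mu]_(x in I) G x.
Proof.
move=> cG; rewrite Rintegral_square21; last first.
  by move=> z; apply: continuous_comp; [exact: cvg_snd|exact: cG].
apply: eq_Rintegral => x _ /=; rewrite Rintegral_cst//=.
by rewrite lebesgue_measure_itv /= lte01 oppr0 adde0 mulr1.
Qed.

Lemma le_Rintegral_square F1 F2 : continuous F1 -> continuous F2 ->
  (forall z, F1 z <= F2 z) -> sqint F1 <= sqint F2.
Proof.
move=> c1 c2 F12; apply: le_Rintegral => //; first exact: measurableX.
  exact: continuous_integrable_square.
exact: continuous_integrable_square.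
Qed.

End square.

(** * Area, variance and biaxial projection of a conformal metric *)

Section conformal.
Context {R : realType} (f : torus R -> R).
Hypotheses (f_continuous : continuous f) (f_gt0 : forall p, 0 < f p).
Local Notation mu := (@lebesgue_measure R).
Local Notation I := (`[0%R, 1%R]%classic : set R).
Local Notation F := (f \o torus_pi).
Local Notation sys := (sys (conformal_metric f)).

Let F_continuous : continuous F.
Proof. exact/quotient_continuous. Qed.

Lemma area_conformal : area (conformal_metric f) = torus_int (fun p => f p ^+ 2).
Proof.
apply: eq_Rintegral => z _; rewrite detZ det1 mulr1 sqrtr_sqr ger0_norm//.
by rewrite sqr_ge0.
Qed.

(** The square is expanded and integrated termwise; the constant term integrates to itself because
    the total mass is 1. *)
Lemma torus_VarE : torus_Var f = torus_int (fun p => f p ^+ 2) - torus_E f ^+ 2.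
Proof.
rewrite /torus_Var {1}/torus_E.
have cF2 : continuous (fun z => f (torus_pi z) ^+ 2).
  move=> z; apply: (@continuous_comp _ _ _ F (fun x => x ^+ 2)).
    exact: F_continuous.
  exact: exprn_continuous.
have cFE : continuous (fun z => (- 2 * torus_E f) * f (torus_pi z)).
  by move=> z; apply: cvgM; [exact: cvg_cst|exact: F_continuous].
have cE : continuous (cst (torus_E f ^+ 2) : R * R -> R).
  by move=> z; exact: cvg_cst.
transitivity (\int[(mu \x mu)%E]_(z in I `*` I)
    (f (torus_pi z) ^+ 2 + ((- 2 * torus_E f) * f (torus_pi z) + torus_E f ^+ 2))).
  by apply: eq_Rintegral => z _; ring.
rewrite Rintegral_squareD//; last by move=> z; apply: cvgD; [exact: cFE|exact: cE].
rewrite Rintegral_squareD// Rintegral_squareZl; last exact: F_continuous.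
rewrite Rintegral_square_cst; set A := torus_int _; set e := torus_E f.
change (A + (- 2 * e * e + e ^+ 2) = A - e ^+ 2); ring.
Qed.

Lemma torus_L1norm_P_BA_le : torus_L1norm (P_BA f) <= 4 * (torus_E f - sys).
Proof.
pose G x := \int[mu]_(y in I) F (x, y).
pose H y := \int[mu]_(x in I) F (x, y).
have cG : continuous G by exact: continuous_Rintegral_slice.
have cH : continuous H.
  exact: (continuous_Rintegral_slice (F := fun z => F (z.2, z.1))
    (continuous_swap F_continuous)).
have cG1 : continuous (G \o fst : R * R -> R).
  by move=> z; apply: continuous_comp; [exact: cvg_fst|exact: cG].
have cH2 : continuous (H \o snd : R * R -> R).
  by move=> z; apply: continuous_comp; [exact: cvg_snd|exact: cH].
have f_ge0 p : 0 <= f p by exact: ltW.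
(* [G x] and [H y] are the lengths of the vertical loop at [x] and of the horizontal loop at [y]. *)
have sG x : sys <= G x by exact: (sys_le_straight false x f_ge0).
have sH y : sys <= H y by exact: (sys_le_straight true y f_ge0).
have EG : \int[mu]_(x in I) G x = torus_E f.
  by rewrite -Rintegral_square12.
have EH : \int[mu]_(y in I) H y = torus_E f.
  by rewrite -Rintegral_square21.
have ck (k : R) : continuous (cst k : R * R -> R) by move=> z; exact: cvg_cst.
have sE : sys <= torus_E f.
  rewrite -EG -Rintegral_square_fst// -[leLHS]Rintegral_square_cst.
  exact: le_Rintegral_square (ck sys) cG1 (fun z => sG z.1).
have -> : torus_L1norm (P_BA f) = (\int[(mu \x mu)%E]_(z in I `*` I)
   `|G z.1 - torus_E f + (H z.2 - torus_E f)|).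
  by apply: eq_Rintegral => -[x y] _; rewrite P_BA_pi.
(* With m = [torus_E f - sys], the bound g + h + 4 m equals G + H + [k], where g and h are [G] and
   [H] minus [torus_E f]. Its integral is [2 * torus_E f + k], that is 4 m. *)
pose k := 2 * torus_E f - 4 * sys.
apply: (@le_trans _ _ (\int[(mu \x mu)%E]_(z in I `*` I)
    ((G \o fst) z + ((H \o snd) z + k)))).
  apply: le_Rintegral_square => [z|z|z /=].
  - apply: cvg_norm; apply: cvgD.
      by apply: cvgB; [exact: cG1|exact: cvg_cst].
    by apply: cvgB; [exact: cH2|exact: cvg_cst].
  - by apply: cvgD; [exact: cG1|apply: cvgD; [exact: cH2|exact: cvg_cst]].
  - have := sG z.1; have := sH z.2; rewrite ler_norml /k => ? ?.
    by apply/andP; split; lra.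
rewrite Rintegral_squareD//; last first.
  by move=> z; apply: cvgD; [exact: cH2|exact: cvg_cst].
rewrite (Rintegral_squareD cH2 (ck k)).
rewrite Rintegral_square_fst// Rintegral_square_snd// Rintegral_square_cst.
by rewrite EG EH /k; lra.
Qed.

End conformal.

Theorem theorem1p2 (R : realType) (f : torus R -> R)
    (f_continuous : continuous f) (f_gt0 : forall p : torus R, 0 < f p) :
  area (conformal_metric f) - sys (conformal_metric f) ^+ 2 >=
    torus_Var f + 16^-1 * torus_L1norm (P_BA f) ^+ 2.
Proof.
rewrite area_conformal torus_VarE//.
have P_ge0 : 0 <= torus_L1norm (P_BA f) by apply: Rintegral_ge0.
have P_le := torus_L1norm_P_BA_le f_continuous f_gt0.
have := sys_ge0 (conformal_metric f).
move: (sys _) (torus_E f) (torus_L1norm _) (torus_int _) P_ge0 P_le => s E P A.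
(* The integral [A] cancels. Then P^2 / 16 <= (E - s)^2, and E^2 - s^2 - (E - s)^2 = 2 s (E - s) >=
   0. *)
by nra.
Qed.
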